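(* Let $\lambda>0$ and let $\Omega_\lambda$ be the set of functions $f$ analytic in $\mathbb{D}=\{z:|z|<1\}$ with $f(0)=0$, $f'(0)=1$, such that $zf'(z)-f(z)=\lambda z^2\phi(z)$ for $z\in\mathbb{D}$ for some analytic $\phi$ in $\mathbb{D}$ with $|\phi(z)|\le1$. The radius of starlikeness of $\Omega_\lambda$ is $\frac{1}{2\lambda}$. Further, if $f\in\Omega_\lambda$, then for $z\in\mathbb{D}$, \[|z|-\lambda|z|^2\le|f(z)|\le|z|+\lambda|z|^2,\qquad 1-2\lambda|z|\le|f'(z)|\le1+2\lambda|z|.\] For $z\in\mathbb{D}$, $z\neq0$, equality occurs in both inequalities if and only if $f(z)=z+\lambda\eta z^2$ with $|\eta|=1$.
   Context: The radius of starlikeness of a class $E$ of normalized analytic functions on $\mathbb{D}$ is $\inf_{f\in E}\gamma_f$, where $\gamma_f$ is the largest $\gamma$ such that $f$ is starlike (i.e. $\mathrm{Re}(zf'(z)/f(z))>0$) in every disk $|z|<r$, $0<r\le\gamma$.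
   Formalization: The radius is stated as min(1, 1/(2λ)), since f lives only on the unit disk; in the equality clause, for each z≠0 a suitable η (not every η) gives equality in both upper bounds, and in both lower bounds when 2λ|z|≤1. *)

(* Defs.v *)
From HB Require Import structures.
From mathcomp Require Import all_boot all_order all_algebra.
From mathcomp Require Import all_classical all_reals all_analysis.
From mathcomp Require Import complex.
Set Implicit Arguments. Unset Strict Implicit. Unset Printing Implicit Defensive.
Import Order.TTheory GRing.Theory Num.Theory.
Import numFieldNormedType.Exports.
Local Open Scope ring_scope.
Local Open Scope complex_scope.
Local Open Scope classical_set_scope.

Section Defs.
Variable R : realType.
Local Notation C := R[i].

Definition cderiv (f : C -> C) (z : C) : C := @derive1 C C^o f z.

Definition unit_disk : set C := [set z | `|z| < 1].

(* analytic (= complex differentiable at every point) in the unit disk *)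
Definition analytic_in_disk (f : C -> C) : Prop :=
  forall z, `|z| < 1 -> derivable (f : C^o -> C^o) z 1.

Definition normalized (f : C -> C) : Prop :=
  analytic_in_disk f /\ f 0 = 0 /\ cderiv f 0 = 1.

Definition Omega (lam : R) (f : C -> C) : Prop :=
  normalized f /\
  exists phi : C -> C, analytic_in_disk phi /\
    (forall z, `|z| < 1 -> `|phi z| <= 1) /\
    (forall z, `|z| < 1 -> z * cderiv f z - f z = (lam%:C) * z ^+ 2 * phi z).

Definition starlike_in_disk (f : C -> C) (r : R) : Prop :=
  forall z : C, 0 < `|z| -> `|z| < r%:C -> 0 < complex.Re (z * cderiv f z / f z).

Definition gamma_star (f : C -> C) : R :=
  sup [set g : R | 0 < g <= 1 /\
                   (forall r : R, 0 < r <= g -> starlike_in_disk f r)].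

Definition radius_starlike (E : (C -> C) -> Prop) : R :=
  inf [set gamma_star f | f in E].

End Defs.

(* Main.v *)
(** Put [q z = f z / z] with [q 0 = 1].  The relation [z f' z - f z = lam z^2 phi z] says
    that [q' = lam phi], so [|q z - 1| <= lam |z|] by the mean value inequality.  The
    growth and distortion bounds, and starlikeness for [|z| < 1 / (2 lam)], follow from
    [f = z q] and [f' = q + z q'].

    Equality in one of the bounds at some [z <> 0] forces [|q z - 1| = lam |z|].  The mean
    value inequality is then an equality, which leaves only [q z - 1 = q' 0 * z], so that
    [|q' 0| = lam].  Hence [(q w - 1) / w] is bounded by [lam] on the disk and attains
    this bound at [0], where its singularity is removable; the maximum modulus principle
    makes it constant.  That principle needs no Cauchy theorem here, because [q'] is
    continuous: the mean over a circle does not change with the radius, by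
    differentiation under the integral sign and the Cauchy-Riemann equations. *)

Require Import Defs.
From HB Require Import structures.
From mathcomp Require Import all_boot all_order all_algebra.
From mathcomp Require Import all_classical all_reals all_analysis.
From mathcomp Require Import complex ring lra.
Import Order.TTheory GRing.Theory Num.Theory.
Import numFieldNormedType.Exports.
Local Open Scope ring_scope.
Local Open Scope complex_scope.
Local Open Scope classical_set_scope.
Import ComplexField.Normc.

Section ComplexAnalysis.
Set Implicit Arguments. Unset Strict Implicit. Unset Printing Implicit Defensive.
Variable R : realType.
Local Notation C := R[i].
Local Notation Co := (R[i]^o).
Local Notation mu := (@lebesgue_measure R).
Local Notation ccontinuous f z := {for (z : Co), continuous (f : Co -> Co)}.
Local Notation is_cderive f z d :=
  (is_derive (z : Co) (1 : Co) (f : Co -> Co) (d : Co)).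
Implicit Types (a c v w y z : C) (f g h dg dh : C -> C).

(** * Modulus *)

Lemma normr_normc z : `|z| = (normc z)%:C. Proof. by []. Qed.

Lemma normr_lt1 z : (`|z| < 1) = (normc z < 1).
Proof. by rewrite normr_normc -[1]/((1 : R)%:C) ltcR. Qed.

Lemma normc_ge0 z : 0 <= normc z.
Proof. exact: (normr_ge0 (z : Rcomplex R)). Qed.

Lemma normc_gt0 z : (0 < normc z) = (z != 0).
Proof. exact: (normr_gt0 (z : Rcomplex R)). Qed.

Lemma normc_real (x : R) : normc x%:C = `|x|.
Proof. by rewrite /= expr0n addr0 sqrtr_sqr. Qed.

Lemma normc_distC z w : normc (z - w) = normc (w - z).
Proof. exact: (distrC (z : Rcomplex R) w). Qed.

Lemma le_normcB z w : normc z - normc w <= normc (z - w).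
Proof. exact: (lerB_dist (z : Rcomplex R) w). Qed.

Lemma ler_dist_normc z w : `|normc z - normc w| <= normc (z - w).
Proof. exact: (ler_dist_dist (z : Rcomplex R) w). Qed.

Lemma normc_sqr z : normc z ^+ 2 = complex.Re z ^+ 2 + complex.Im z ^+ 2.
Proof. by case: z => p q; rewrite /= sqr_sqrtr // addr_ge0 // sqr_ge0. Qed.

Lemma normr_Re_le z : `|complex.Re z| <= normc z.
Proof. by rewrite -lecR -normr_normc; exact: normc_ge_Re. Qed.

Lemma Re_le_normc z : complex.Re z <= normc z.
Proof. exact: le_trans (ler_norm _) (normr_Re_le z). Qed.

Lemma Re_unimodularM_le c z : normc c = 1 -> complex.Re (c * z) <= normc z.
Proof. by move=> c1; apply: le_trans (Re_le_normc _) _; rewrite normcM c1 mul1r. Qed.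

Lemma ReM_real z (x : R) : complex.Re (z * x%:C) = complex.Re z * x.
Proof. by case: z => p q /=; rewrite mulr0 subr0. Qed.

Lemma eq_real_normc_le_Re z (x : R) : normc z <= x -> x <= complex.Re z -> z = x%:C.
Proof.
move=> zx xz; have rez : complex.Re z = x.
  by apply/eqP; rewrite eq_le xz (le_trans (Re_le_normc z)).
suff imz : complex.Im z = 0 by case: z rez imz {zx xz} => p q /= -> ->.
have x0 : 0 <= x := le_trans (normc_ge0 z) zx.
have : normc z ^+ 2 <= x ^+ 2 by rewrite lerXn2r ?nnegrE ?normc_ge0.
rewrite normc_sqr rez gerDl => imz.
by apply/eqP; rewrite -sqrf_eq0 eq_le imz sqr_ge0.
Qed.

Lemma normc_rotation z : exists2 c, normc c = 1 & c * z = (normc z)%:C.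
Proof.
have [->|z0] := eqVneq z 0; first by exists 1; rewrite ?normc1 // mulr0 normc0.
exists ((normc z)%:C / z); last by rewrite divfK.
rewrite normcM normcV normc_real ger0_norm ?normc_ge0 //.
by rewrite divff // gt_eqF ?normc_gt0.
Qed.

(** * Limits and continuity *)

Lemma nbhs_normcP z (P : C -> Prop) :
  (\forall w \near (z : Co), P w) <->
  exists2 d : R, 0 < d & forall w, normc (w - z) < d -> P w.
Proof.
split=> [/(nbhs_normP (z : Co))[e /= e0 eP]|[d d0 dP]].
  have eE : e = (complex.Re e)%:C by rewrite RRe_real // gtr0_real.
  exists (complex.Re e); first by rewrite -ltcR -eE.
  by move=> w wz; apply: eP; rewrite /= eE normr_normc ltcR normc_distC.
apply/(nbhs_normP (z : Co)); exists d%:C; first by rewrite /= ltcR.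
by move=> w /=; rewrite normr_normc ltcR normc_distC => /dP.
Qed.

Lemma cvg_normcP (T : Type) (F : set_system T) (FF : Filter F) (f : T -> C) z :
  ((f : T -> Co) @ F --> (z : Co)) <->
  (forall e : R, 0 < e -> \forall t \near F, normc (f t - z) < e).
Proof.
split=> [fz e e0|fz P /nbhs_normcP[d d0 dP]].
  by apply/(fz (fun w => normc (w - z) < e))/nbhs_normcP; exists e.
by apply: filterS (fz d d0) => t; exact: dP.
Qed.

Lemma ccontinuous_normcP f z : ccontinuous f z <->
  (forall e : R, 0 < e -> exists2 d : R, 0 < d &
     forall w, normc (w - z) < d -> normc (f w - f z) < e).
Proof.
apply: (iff_trans (@cvg_normcP _ _ (nbhs_filter (z : Co)) _ _)).
by split=> fz e /fz /nbhs_normcP.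
Qed.

Lemma cvg_Re (T : Type) (F : set_system T) (FF : Filter F) (f : T -> C) z :
  ((f : T -> Co) @ F --> (z : Co)) -> complex.Re (f t) @[t --> F] --> complex.Re z.
Proof.
move=> /cvg_normcP fz; apply/cvgrPdist_lt => e e0.
apply: filterS (fz e e0) => t; apply: le_lt_trans.
by rewrite -raddfB normc_distC; exact: normr_Re_le.
Qed.

Lemma cvg_real_complex (T : Type) (F : set_system T) (FF : Filter F)
    (x : T -> R) (r : R) :
  x @ F --> r -> ((fun t => (x t)%:C) : T -> Co) @ F --> (r%:C : Co).
Proof.
move=> xr; apply/cvg_normcP => e e0.
near=> t; rewrite -rmorphB normc_real distrC.
by near: t; exact: cvgr_dist_lt.
Unshelve. all: by end_near. Qed.

Lemma cvg_complex (T : Type) (F : set_system T) (FF : Filter F) (x y : T -> R) (p q : R) :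
  x @ F --> p -> y @ F --> q ->
  ((fun t => x t +i* y t) : T -> Co) @ F --> (p +i* q : Co).
Proof.
move=> /cvg_real_complex xp /cvg_real_complex yq; rewrite [p +i* q]complexE.
under eq_fun do rewrite [_ +i* _]complexE.
exact: cvgD xp (cvgM (cvg_cst ('i : Co)) yq).
Qed.

(** * Complex derivatives *)

Lemma is_cderive_continuous g z d : is_cderive g z d -> ccontinuous g z.
Proof. by case=> gz _; apply/differentiable_continuous/derivable1_diffP. Qed.

Lemma derivable_is_cderive g z :
  derivable (g : Co -> Co) z 1 -> is_cderive g z (cderiv g z).
Proof. by move=> /derivableP; rewrite /cderiv derive1E. Qed.

Lemma cderivE g z d : is_cderive g z d -> cderiv g z = d.
Proof. by case=> _ <-; rewrite /cderiv derive1E. Qed.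

Lemma is_cderive_normcP g z d : is_cderive g z d <->
  forall e : R, 0 < e -> exists2 r : R, 0 < r & forall w, normc (w - z) < r ->
    normc (g w - g z - d * (w - z)) <= e * normc (w - z).
Proof.
pose q (v : Co) : Co := v^-1 *: ((g : Co -> Co) (v *: (1 : Co) + z) - g z).
have qE v : v != 0 -> g (v + z) - g z - d * v = (q v - d) * v.
  by move=> v0; rewrite /q /GRing.scale /= mulr1 mulrBl mulrAC mulVf // mul1r.
have -> : is_cderive g z d <-> q v @[v --> 0^'] --> (d : Co).
  split=> [[gz gd]|qd]; first by rewrite -gd; exact: gz.
  apply: DeriveDef; first by apply/cvg_ex; exists d.
  by apply: cvg_lim; first exact: norm_hausdorff.
split=> [/cvg_normcP qd e e0|gd].
  have := qd e e0; rewrite /dnbhs near_withinE => /nbhs_normcP[r r0 rq].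
  exists r => // w wz.
  have [->|w0] := eqVneq w z; first by rewrite !subrr mulr0 subr0 normc0 mulr0.
  have wz0 : w - z != 0 by rewrite subr_eq0.
  have := qE _ wz0; rewrite subrK => ->; rewrite normcM ler_wpM2r ?normc_ge0 // ltW //.
  by apply: rq => //; rewrite subr0.
apply/cvg_normcP => e e0; rewrite /dnbhs near_withinE.
have e2 : 0 < e / 2 by rewrite divr_gt0.
have [r r0 rg] := gd _ e2.
apply/nbhs_normcP; exists r => // v; rewrite subr0 => vr v0.
have := rg (v + z); rewrite addrK qE // => /(_ vr).
rewrite normcM ler_pM2r ?normc_gt0 //; lra.
Qed.

Lemma is_cderive_subr a z : is_cderive (fun w => w - a) z 1.
Proof. by apply: is_derive_eq; exact: subr0. Qed.

Definition dslope g a w : C := if w == a then cderiv g a else (g w - g a) / (w - a).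

Lemma dslope_diag g a : dslope g a a = cderiv g a.
Proof. by rewrite /dslope eqxx. Qed.

Lemma dslopeM g a w : dslope g a w * (w - a) = g w - g a.
Proof.
by rewrite /dslope; case: eqVneq => [->|wa]; rewrite ?subrr ?mulr0 // divfK // subr_eq0.
Qed.

Lemma dslope_continuous g a d : is_cderive g a d -> ccontinuous (dslope g a) a.
Proof.
move=> gd; have /is_cderive_normcP ge := gd.
apply/ccontinuous_normcP => e e0; rewrite dslope_diag (cderivE gd).
have e2 : 0 < e / 2 by rewrite divr_gt0.
have [r r0 rg] := ge _ e2; exists r => // w wr.
have [->|wa] := eqVneq w a; first by rewrite dslope_diag (cderivE gd) subrr normc0.
have wa0 : w - a != 0 by rewrite subr_eq0.
have := rg w wr; rewrite -dslopeM -mulrBl normcM ler_pM2r ?normc_gt0 //; lra.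
Qed.

Lemma is_cderive_dslope g a z d : z != a -> is_cderive g z d ->
  is_cderive (dslope g a) z ((d - dslope g a z) / (z - a)).
Proof.
move=> za gd; have za0 : z - a != 0 by rewrite subr_eq0.
have inv_d : is_cderive (fun w => (w - a)^-1) z (- (z - a) ^- 2).
  have [sub_derivable sub_derive] := is_cderive_subr a z.
  apply: DeriveDef; first exact: derivableV.
  by rewrite deriveV // sub_derive /GRing.scale /= mulr1.
apply: (@near_eq_is_derive _ _ _ (fun w : Co => (g w - g a) * (w - a)^-1 : Co)).
  apply/nbhs_normcP; exists (normc (z - a)) => [|w wz]; first by rewrite normc_gt0.
  by rewrite /dslope ifN //; apply: contraTneq wz => ->; rewrite normc_distC ltxx.
apply: is_derive_eq.
by rewrite /GRing.scale /= /dslope (negPf za); field.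
Qed.

Lemma is_derive_Re_comp g (x y : R -> R) (t dx dy : R) d :
  is_derive t 1 x dx -> is_derive t 1 y dy -> is_cderive g (x t +i* y t) d ->
  is_derive t 1 (fun s => complex.Re (g (x s +i* y s))) (complex.Re (d * (dx +i* dy))).
Proof.
move=> xd yd gd; set a := x t +i* y t in gd.
have xc : {for t, continuous x}.
  by apply/differentiable_continuous/derivable1_diffP; case: xd.
have yc : {for t, continuous y}.
  by apply/differentiable_continuous/derivable1_diffP; case: yd.
have /is_derive1_caratheodory[ex [xE exc <-]] := xd.
have /is_derive1_caratheodory[ey [yE eyc <-]] := yd.
apply/is_derive1_caratheodory.
exists (fun s => complex.Re (dslope g a (x s +i* y s) * (ex s +i* ey s))); split.
- move=> s; rewrite -raddfB -dslopeM -ReM_real -mulrA; congr (complex.Re (_ * _)).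
  by rewrite /GRing.mul /= !(mulr0, subr0, add0r) -xE -yE.
- apply: cvg_Re; apply: (@cvgM _ _ _ _ (fun s => dslope g a (x s +i* y s) : Co)).
    by apply: continuous_cvg (dslope_continuous gd) _; exact: cvg_complex.
  exact: cvg_complex.
- by rewrite dslope_diag (cderivE gd).
Qed.

(** * Mean value inequality *)

Lemma segmentE a v (t : R) : a + t%:C * v =
  (complex.Re a + t * complex.Re v) +i* (complex.Im a + t * complex.Im v).
Proof. by case: a => ? ?; case: v => ? ?; rewrite /GRing.mul /= !mul0r subr0 addr0. Qed.

Lemma normc_segment a v (t : R) : normc (a + t%:C * v - a) = `|t| * normc v.
Proof. by rewrite addrAC subrr add0r normcM normc_real. Qed.

Lemma segment_disk a v (t r : R) : normc v < r -> `|t| <= 1 ->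
  normc (a + t%:C * v - a) < r.
Proof.
by move=> vr t1; rewrite normc_segment (le_lt_trans _ vr) // ler_piMl ?normc_ge0.
Qed.

Lemma segment_neq a v (t : R) : v != 0 -> t != 0 -> a + t%:C * v != a.
Proof.
move=> v0 t0; rewrite -subr_eq0 -normc_gt0 normc_segment.
by rewrite mulr_gt0 ?normr_gt0 ?normc_gt0.
Qed.

Lemma is_derive_Re_segment g a v d (t : R) : is_cderive g (a + t%:C * v) d ->
  is_derive t 1 (fun s : R => complex.Re (g (a + s%:C * v))) (complex.Re (d * v)).
Proof.
have affine (p q : R) : is_derive t 1 (fun s : R => p + s * q) q.
  by apply: is_derive_eq; rewrite /GRing.scale /=; ring.
under eq_fun do rewrite segmentE.
rewrite segmentE => /(is_derive_Re_comp (affine _ _) (affine _ _)).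
by case: v.
Qed.

Lemma continuous_Re_segment g a v (t : R) : ccontinuous g (a + t%:C * v) ->
  {for t, continuous (fun s : R => complex.Re (g (a + s%:C * v)))}.
Proof.
move=> gc; apply: cvg_Re; apply: continuous_cvg gc _.
have tC : (s%:C : Co) @[s --> t] --> (t%:C : Co).
  by apply: cvg_real_complex; exact: cvg_id.
exact: cvgD (cvg_cst _) (cvgM tC (cvg_cst (v : Co))).
Qed.

Lemma segment_mean_value g dg a v (M : R) :
  (forall t : R, 0 <= t <= 1 -> ccontinuous g (a + t%:C * v)) ->
  (forall t : R, 0 < t < 1 -> is_cderive g (a + t%:C * v) (dg (a + t%:C * v))) ->
  (forall t : R, 0 < t < 1 -> normc (dg (a + t%:C * v)) <= M) ->
  normc (g (a + v) - g a) <= M * normc v.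
Proof.
move=> gc gd dgM.
have [c c1 cE] := normc_rotation (g (a + v) - g a).
pose u (s : R) := complex.Re (c * g (a + s%:C * v)).
have [||t] := @MVT R u (fun s => complex.Re (c * dg (a + s%:C * v) * v)) 0 1 ltr01.
- move=> t /[!in_itv] /= t01.
  apply: (@is_derive_Re_segment (fun w => c * g w)).
  exact: (is_deriveZ _ (gd _ t01)).
- apply: continuous_in_subspaceT => t /[!inE] /= /[!in_itv] /= t01.
  apply: (@continuous_Re_segment (fun w => c * g w)).
  exact: cvgM (cvg_cst (c : Co)) (gc _ t01).
rewrite in_itv /= => t01.
rewrite /u mul0r addr0 mul1r subr0 mulr1 -raddfB -mulrBr cE /= => ->.
rewrite -mulrA; apply: le_trans (Re_unimodularM_le _ c1) _.
by rewrite normcM ler_wpM2r ?normc_ge0 ?dgM.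
Qed.

Lemma disk_mean_value g dg a (r M : R) :
  (forall z, normc (z - a) < r -> is_cderive g z (dg z)) ->
  (forall z, normc (z - a) < r -> normc (dg z) <= M) ->
  {in [pred z | normc (z - a) < r] &, forall z w, normc (g z - g w) <= M * normc (z - w)}.
Proof.
move=> gd dgM z w; rewrite !inE => zr wr.
have seg_disk (t : R) : 0 <= t <= 1 -> normc (w + t%:C * (z - w) - a) < r.
  move=> /andP[t0 t1].
  have -> : w + t%:C * (z - w) - a = t%:C * (z - a) + (1 - t)%:C * (w - a).
    by rewrite rmorphB rmorph1 /=; ring.
  apply: le_lt_trans (le_normcD _ _) _; rewrite !normcM !normc_real.
  rewrite !ger0_norm ?subr_ge0 //.
  by case: (leP (normc (z - a)) (normc (w - a))) => ?; nra.
rewrite -[z in g z](subrKC w); apply: (segment_mean_value (dg := dg)) => t.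
- by move=> /seg_disk /gd /is_cderive_continuous.
- by move=> /andP[t0 t1]; apply/gd/seg_disk; rewrite !ltW.
- by move=> /andP[t0 t1]; apply/dgM/seg_disk; rewrite !ltW.
Qed.

Lemma is_cderive_removable g dg a (r : R) : 0 < r ->
  ccontinuous g a -> ccontinuous dg a ->
  (forall z, z != a -> normc (z - a) < r -> is_cderive g z (dg z)) ->
  is_cderive g a (dg a).
Proof.
move=> r0 gc dgc gd; apply/is_cderive_normcP => e e0.
have [d d0 dgd] := (ccontinuous_normcP _ _).1 dgc e e0.
exists (Num.min r d) => [|w]; first by rewrite lt_min r0.
rewrite lt_min => /andP[wr wd].
have [->|wa] := eqVneq w a; first by rewrite !subrr mulr0 subr0 normc0 mulr0.
have wa0 : w - a != 0 by rewrite subr_eq0.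
pose h z := g z - dg a * z.
have hd z : is_cderive g z (dg z) -> is_cderive h z (dg z - dg a).
  by move=> gz; apply: is_derive_eq; rewrite /GRing.scale /= mulr1.
suff : normc (h (a + (w - a)) - h a) <= e * normc (w - a).
  by rewrite subrKC; congr (normc _ <= _); rewrite /h; ring.
apply: (segment_mean_value (dg := fun z => dg z - dg a)) => t /andP[t0 t1].
- have [->|tn0] := eqVneq t 0; last first.
    apply/(is_cderive_continuous (hd _ _))/gd; first exact: segment_neq.
    by rewrite segment_disk // ger0_norm.
  by rewrite mul0r addr0; apply: cvgB gc _; apply: mulrl_continuous.
- apply/hd/gd; first by rewrite segment_neq // gt_eqF.
  by rewrite segment_disk // gtr0_norm ?ltW.
- by apply/ltW/dgd; rewrite segment_disk // gtr0_norm ?ltW.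
Qed.

Lemma is_cderive_segment_approx g a d v (e : R) : is_cderive g a d -> 0 < e ->
  exists2 t : R, 0 < t <= 1 & normc (g (a + t%:C * v) - g a - d * (t%:C * v)) <= e * t.
Proof.
move=> /is_cderive_normcP gd e0.
have nv1 : 0 < normc v + 1 by rewrite ltr_wpDl // normc_ge0.
have [r r0 linear] := gd _ (divr_gt0 e0 nv1).
pose t := Num.min 1 (r / (normc v + 1)).
have t0 : 0 < t by rewrite lt_min ltr01 divr_gt0.
have tr : t * (normc v + 1) <= r by rewrite -ler_pdivlMr // ge_min lexx orbT.
exists t; first by rewrite t0 ge_min lexx.
have := linear (a + t%:C * v); rewrite normc_segment gtr0_norm //.
rewrite [a + _ - a]addrAC subrr add0r => /(_ _)/le_trans; apply; first nra.
by rewrite mulrAC ler_pdivrMr // -mulrA ler_pM2l // ler_pM2l // lerDl.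
Qed.

(* To first order the initial piece of the segment from [a] to [z] contributes
   [t * dg a * (z - a)], and the rest at most [(1 - t) * M * normc (z - a)]: the
   total is extremal only if [dg a * (z - a)] already has the size and the
   direction of the increment. *)
Lemma disk_mean_value_eq g dg a z (r M : R) :
  (forall w, normc (w - a) < r -> is_cderive g w (dg w)) ->
  (forall w, normc (w - a) < r -> normc (dg w) <= M) ->
  normc (z - a) < r -> normc (g z - g a) = M * normc (z - a) ->
  g z - g a = dg a * (z - a).
Proof.
move=> gd dgM zr gE; have [->|za] := eqVneq z a; first by rewrite !subrr mulr0.
set v := z - a in zr gE *.
have v0 : v != 0 by rewrite subr_eq0.
have nv : 0 < normc v by rewrite normc_gt0.
have a_disk : normc (a - a) < r by rewrite subrr normc0 (lt_trans nv).
have [c c1 cE] := normc_rotation (g z - g a).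
have c0 : c != 0 by rewrite -normc_gt0 c1.
apply/esym/(mulfI c0); rewrite cE; apply: eq_real_normc_le_Re.
  by rewrite !normcM c1 mul1r gE ler_pM2r // dgM.
apply/ler_addgt0Pr => e e0.
have [t /andP[t0 t1] start] := is_cderive_segment_approx v (gd _ a_disk) e0.
pose w := a + t%:C * v.
have rest : normc (g z - g w) <= (1 - t) * normc (g z - g a).
  apply: le_trans (disk_mean_value gd dgM _ _) _; rewrite ?inE //.
    by rewrite segment_disk // gtr0_norm.
  have -> : z - w = (1 - t)%:C * v by rewrite /w /v rmorphB rmorph1 /=; ring.
  by rewrite normcM normc_real ger0_norm ?subr_ge0 // gE mulrCA.
rewrite -(ler_pM2r t0) mulrDl -ReM_real.
have -> : c * (dg a * v) * t%:C = c * (dg a * (t%:C * v)) by ring.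
have : normc (g z - g a) = complex.Re (c * (dg a * (t%:C * v))) +
    complex.Re (c * (g w - g a - dg a * (t%:C * v))) + complex.Re (c * (g z - g w)).
  rewrite -!raddfD /= -[LHS]/(complex.Re (normc _)%:C) -cE.
  by congr complex.Re; ring.
have := le_trans (Re_unimodularM_le _ c1) start.
have := le_trans (Re_unimodularM_le _ c1) rest; lra.
Qed.

(** * Mean value property and maximum modulus *)

Lemma continuous_segment_integrable (f : R -> R) (p q : R) :
  continuous f -> mu.-integrable `[p, q] (EFin \o f).
Proof.
move=> fc; apply: continuous_compact_integrable; first exact: segment_compact.
exact: continuous_subspaceT.
Qed.

Lemma Rintegral_eq0_continuous (f : R -> R) (p q : R) :
  continuous f -> (forall x, p <= x <= q -> 0 <= f x) ->
  \int[mu]_(x in `[p, q]) f x = 0 -> forall x, p < x < q -> f x = 0.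
Proof.
move=> fc f0 intf x /andP[px xq].
have fi := continuous_segment_integrable _ _ fc.
pose F x := \int[mu]_(t in `[p, x]) f t.
have F0 t : p < t < q -> F t = 0.
  move=> /andP[pt tq]; apply/eqP; rewrite eq_le; apply/andP; split; last first.
    rewrite /F; apply: Rintegral_ge0 => s; rewrite /= in_itv /= => /andP[ps st].
    by rewrite f0 // ps (le_trans st) ?ltW.
  have := @Rintegral_itvB _ f (BLeft p) (BRight q) t (fi p q).
  rewrite !bnd_simp intf sub0r -oppr_ge0 => -> //; try exact: ltW.
  apply: Rintegral_ge0 => s; rewrite /= in_itv /= => /andP[ts sq].
  by rewrite f0 // sq (le_trans (ltW pt)) ?ltW.
have [_ <-] := continuous_FTC1_closed xq (fi p q) px (fc x).
rewrite derive1E -[RHS](derive_cst (0 : R) x 1); apply: near_eq_derive.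
near=> t; apply: F0; apply/andP; split; near: t.
  exact: lt_nbhsr.
exact: lt_nbhsl.
Unshelve. all: by end_near. Qed.

Lemma continuous_rectangle_bounded (f : R * R -> R) (u v p q : R) :
  (forall t s, u <= t <= v -> p <= s <= q -> {for (t, s), continuous f}) ->
  exists2 M : R, 0 <= M & forall t s, u <= t <= v -> p <= s <= q -> `|f (t, s)| <= M.
Proof.
move=> fc; pose K : set (R * R) := `[u, v] `*` `[p, q].
have Kc : compact K by apply: compact_setX; exact: segment_compact.
have fK : {within K, continuous f}.
  apply: continuous_in_subspaceT => -[t s] /[!inE] -[] /=.
  by rewrite !in_itv; exact: fc.
have [M [_ fM]] := compact_bounded (continuous_compact fK Kc).
exists (`|M| + 1) => [|t s tuv spq]; first by rewrite addr_ge0.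
apply: fM; first by rewrite ltr_pwDr // ler_norm.
by exists (t, s) => //; split; rewrite /= in_itv.
Qed.

Definition cis (th : R) : C := cos th +i* sin th.

Lemma normc_cis th : normc (cis th) = 1.
Proof. by rewrite /= cos2Dsin2 sqrtr1. Qed.

Lemma cis0 : cis 0 = 1.
Proof. by rewrite /cis cos0 sin0. Qed.

Lemma continuous_cis : continuous (cis : R -> Co).
Proof.
by move=> th; apply: cvg_complex; [exact: continuous_cos|exact: continuous_sin].
Qed.

Definition polar a y (t th : R) : C := a + t%:C * (y * cis th).

Lemma normc_polar a y (t th : R) : normc (polar a y t th - a) = `|t| * normc y.
Proof. by rewrite normc_segment normcM normc_cis mulr1. Qed.

Lemma polar_neq a y (t th : R) : y != 0 -> t != 0 -> polar a y t th != a.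
Proof.
move=> y0; apply: segment_neq; rewrite mulf_neq0 //.
by rewrite -normc_gt0 normc_cis.
Qed.

Lemma polar_continuous a y : continuous (fun p : R * R => polar a y p.1 p.2 : Co).
Proof.
move=> [t th] /=; apply: cvgD; first exact: cvg_cst.
apply: (@cvgM _ _ _ _ (fun p : R * R => p.1%:C : Co)).
  by apply: cvg_real_complex; exact: cvg_fst.
apply: (@cvgM _ _ _ _ (cst y : R * R -> Co)); first exact: cvg_cst.
by apply: (@cvg_comp _ _ _ _ (cis : R -> Co)); [exact: cvg_snd|exact: continuous_cis].
Qed.

Lemma polarE a y (t th : R) : polar a y t th =
  (complex.Re a + t * (complex.Re y * cos th - complex.Im y * sin th)) +i*
  (complex.Im a + t * (complex.Re y * sin th + complex.Im y * cos th)).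
Proof. by rewrite /polar segmentE; case: y. Qed.

Lemma is_derive_Im_polar g a y d (t th : R) : is_cderive g (polar a y t th) d ->
  is_derive th 1 (fun s => complex.Im (g (polar a y t s)))
    (t * complex.Re (d * (y * cis th))).
Proof.
move=> gd; pose k w := - 'i * g w.
have kd : is_cderive k (polar a y t th) (- 'i * d) by exact: is_deriveZ.
have -> : (fun s => complex.Im (g (polar a y t s))) =
    (fun s => complex.Re (k (polar a y t s))).
  by apply/funext => s; rewrite /k mulNr mulrC raddfN /= ReiNIm opprK.
under eq_fun do rewrite polarE.
have xd : is_derive th 1
  (fun s => complex.Re a + t * (complex.Re y * cos s - complex.Im y * sin s))
  (t * (- (complex.Re y * sin th) - complex.Im y * cos th)).
  by apply: is_derive_eq; rewrite /GRing.scale /=; ring.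
have yd : is_derive th 1
  (fun s => complex.Im a + t * (complex.Re y * sin s + complex.Im y * cos s))
  (t * (complex.Re y * cos th - complex.Im y * sin th)).
  by apply: is_derive_eq; rewrite /GRing.scale /=; ring.
rewrite polarE in kd; apply: is_derive_eq (is_derive_Re_comp xd yd kd) _.
by case: (d) => p q; case: (y) => x z /=; ring.
Qed.

(* Continuity of the derivative is required, not deduced from Cauchy's theorem;
   the centre itself may be a removable singularity. *)
Definition holomorphic_off_center h dh a (r : R) : Prop :=
  forall z, normc (z - a) < r -> ccontinuous h z /\
    (z != a -> is_cderive h z (dh z) /\ ccontinuous dh z).

Lemma holomorphic_off_centerZ c h dh a (r : R) : holomorphic_off_center h dh a r ->
  holomorphic_off_center (fun z => c * h z) (fun z => c * dh z) a r.
Proof.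
move=> hh z zr; have [hc hd] := hh z zr.
split=> [|/hd[hzd dhc]]; first exact: cvgM (cvg_cst (c : Co)) hc.
by split; [exact: is_deriveZ|exact: cvgM (cvg_cst (c : Co)) dhc].
Qed.

Definition circle_mean (u : C -> R) a y : R :=
  (2 * pi)^-1 * \int[mu]_(th in `[- pi, pi]) u (a + y * cis th).

Lemma Rintegral_cst_circle (x : R) : \int[mu]_(_ in `[- pi, pi]) x = 2 * pi * x.
Proof.
rewrite Rintegral_cst //= lebesgue_measure_itv /= lte_fin.
have pi0 := pi_gt0 R.
by rewrite ifT /=; [ring|lra].
Qed.

Lemma circle_mean0 (u : C -> R) a : circle_mean u a 0 = u a.
Proof.
rewrite /circle_mean; under eq_Rintegral do rewrite mul0r addr0.
by rewrite Rintegral_cst_circle mulKf // mulf_neq0 // gt_eqF ?pi_gt0.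
Qed.

Lemma circle_mean_eq_max (u : C -> R) a y (M : R) :
  continuous (fun th : R => u (a + y * cis th)) ->
  (forall th, u (a + y * cis th) <= M) -> circle_mean u a y = M -> u (a + y) = M.
Proof.
move=> uc uM mean_eq; have pi0 := pi_gt0 R.
suff : M - u (a + y * cis 0) = 0 by rewrite cis0 mulr1 => /subr0_eq.
apply: (@Rintegral_eq0_continuous (fun th => M - u (a + y * cis th)) (- pi) pi).
- by move=> th; exact: cvgB (cvg_cst _) (uc th).
- by move=> th _; rewrite subr_ge0.
- have M_int := continuous_segment_integrable (- pi) pi (@cst_continuous _ _ M).
  rewrite RintegralB //; last exact: continuous_segment_integrable.
  rewrite Rintegral_cst_circle -mean_eq /circle_mean mulVKf ?subrr //.
  by rewrite mulf_neq0 // gt_eqF.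
- by rewrite oppr_lt0 pi0.
Qed.

(* The radial derivative of [Re h] is, up to the factor [1 / t], the angular
   derivative of [Im h], whose integral over the whole circle vanishes; so the
   integral over the circle of radius [t |y|] does not depend on [t]. *)
Section RadialIndependence.
Variables (h dh : C -> C) (a y : C) (r : R).
Hypotheses (y0 : y != 0) (yr : normc y < r) (hh : holomorphic_off_center h dh a r).

Let u (t th : R) : R := complex.Re (h (polar a y t th)).
Let du (t th : R) : R := complex.Re (dh (polar a y t th) * (y * cis th)).

Let polar_holomorphic (t th : R) : 0 < t <= 1 ->
  is_cderive h (polar a y t th) (dh (polar a y t th)) /\ ccontinuous dh (polar a y t th).
Proof.
move=> /andP[t0 t1]; have t_neq0 : t != 0 by rewrite gt_eqF.
have [|_] := hh (z := polar a y t th); last by apply; exact: polar_neq.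
by rewrite normc_polar gtr0_norm //; apply: le_lt_trans yr; rewrite ler_piMl ?normc_ge0.
Qed.

Lemma continuous_Re_polar (t th : R) : `|t| * normc y < r ->
  {for (t, th), continuous (fun p : R * R => u p.1 p.2)}.
Proof.
move=> tr; apply: cvg_Re.
apply: (@continuous_cvg _ _ _ _ _ _ (h : Co -> Co)); last exact: polar_continuous.
by have [|] := hh (z := polar a y t th); rewrite ?normc_polar.
Qed.

Lemma continuous_radial_derivative (t th : R) : 0 < t <= 1 ->
  {for (t, th), continuous (fun p : R * R => du p.1 p.2)}.
Proof.
move=> /polar_holomorphic-/(_ th)[_ dhc]; apply: cvg_Re.
apply: (@cvgM _ _ _ _ (fun p : R * R => dh (polar a y p.1 p.2) : Co)).
  apply: (@continuous_cvg _ _ _ _ _ _ (dh : Co -> Co)); first exact: dhc.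
  exact: polar_continuous.
apply: (@cvgM _ _ _ _ (cst y : R * R -> Co)); first exact: cvg_cst.
by apply: (@cvg_comp _ _ _ _ (cis : R -> Co)); [exact: cvg_snd|exact: continuous_cis].
Qed.

Lemma is_derive_radial (t th : R) : 0 < t <= 1 -> is_derive t 1 (u ^~ th) (du t th).
Proof. by move=> /polar_holomorphic-/(_ th)[hd _]; exact: is_derive_Re_segment. Qed.

Lemma integrable_Re_polar (t : R) : `|t| * normc y < r ->
  mu.-integrable `[- pi, pi] (EFin \o u t).
Proof.
move=> tr; apply: continuous_segment_integrable => th.
apply: (@cvg_comp _ _ _ (fun s => (t, s)) (fun p : R * R => u p.1 p.2)).
  exact: cvg_pair (cvg_cst _) cvg_id.
exact: continuous_Re_polar.
Qed.

Lemma Rintegral_radial_derivative (t : R) : 0 < t <= 1 ->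
  \int[mu]_(th in `[- pi, pi]) du t th = 0.
Proof.
move=> t01; have t0 : t != 0 by case/andP: t01 => /gt_eqF ->.
have duc : continuous (du t).
  move=> th; apply: (@cvg_comp _ _ _ (fun s => (t, s)) (fun p : R * R => du p.1 p.2)).
    exact: cvg_pair (cvg_cst _) cvg_id.
  exact: continuous_radial_derivative.
pose v th := complex.Im (h (polar a y t th)).
have vd (th : R) : is_derive th 1 v (t * du t th).
  by have [hd _] := polar_holomorphic th t01; exact: is_derive_Im_polar hd.
have vc : continuous v.
  by move=> th; apply/differentiable_continuous/derivable1_diffP; case: (vd th).
apply: (mulfI t0); rewrite mulr0.
rewrite -RintegralZl //; last exact: continuous_segment_integrable.
rewrite /Rintegral (@continuous_FTC2 _ _ v).
- by rewrite -EFinB /= /v /polar /cis cosN sinN sinpi oppr0 subrr.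
- by have := pi_gt0 R; lra.
- by apply: continuous_subspaceT => th; exact: cvgM (cvg_cst _) (duc th).
- by split=> [th _||]; [case: (vd th)|exact: cvg_at_right_filter (vc _)|
    exact: cvg_at_left_filter (vc _)].
- by move=> th _; rewrite derive1E; case: (vd th).
Qed.

Lemma is_derive_circle_integral (t : R) : 0 < t < 1 ->
  is_derive t 1 (fun s => \int[mu]_(th in `[- pi, pi]) u s th) 0.
Proof.
move=> /andP[t0 t1].
have [|M M0 duM] :=
    @continuous_rectangle_bounded (fun p => du p.1 p.2) (t / 2) 1 (- pi) pi.
  move=> s th /andP[s0 s1] _; apply: continuous_radial_derivative.
  by rewrite s1 andbT; lra.
have half s : `]t / 2, 1[%classic s -> 0 < s <= 1.
  by rewrite /= in_itv /= => /andP[s0 /ltW ->]; rewrite andbT; lra.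
have t_in : `]t / 2, 1[%classic t by rewrite /= in_itv /= t1 andbT; lra.
have mI : measurable (`[- pi, pi] : set (measurableTypeR R)) by [].
have u_int s : `]t / 2, 1[%classic s -> mu.-integrable `[- pi, pi] (EFin \o u s).
  move=> /half /andP[s0 s1]; apply: integrable_Re_polar; apply: le_lt_trans yr.
  by rewrite gtr0_norm // ler_piMl ?normc_ge0.
have u_der (s th : R) : `]t / 2, 1[%classic s -> `[- pi, pi]%classic th ->
    derivable (u ^~ th) s 1.
  by move=> /half s01 _; case: (is_derive_radial th s01).
have partialE (s th : R) : `]t / 2, 1[%classic s -> partial1of2 u s th = du s th.
  by move=> /half s01; rewrite partial1of2E; case: (is_derive_radial th s01).
have M_int := continuous_segment_integrable (- pi) pi (@cst_continuous _ _ M).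
have d_bound (s th : R) : `]t / 2, 1[%classic s -> `[- pi, pi]%classic th ->
    `|partial1of2 u s th| <= cst M th.
  move=> s_in; rewrite partialE //= in_itv /=; move: s_in; rewrite /= in_itv /=.
  by move=> /andP[s0 s1]; apply: duM; rewrite !ltW.
apply: DeriveDef.
  exact: (derivable_under_integral mI t_in u_int u_der (fun=> M0) M_int d_bound).
rewrite -derive1E.
rewrite (differentiation_under_integral mI t_in u_int u_der (fun=> M0) M_int d_bound).
under eq_Rintegral do rewrite partialE //.
by apply: Rintegral_radial_derivative; rewrite t0 ltW.
Qed.

Lemma continuous_circle_integral (t : R) : 0 <= t <= 1 ->
  {for t, continuous (fun s => \int[mu]_(th in `[- pi, pi]) u s th)}.
Proof.
move=> /andP[t0 t1].
have [T T1 Ty] : exists2 T, 1 < T & T * normc y < r.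
  have ny := normc_ge0 y; have y_lt_r := yr; have ry : 0 < r + normc y by lra.
  exists (2 * r / (r + normc y)); first by rewrite ltr_pdivlMr //; lra.
  by rewrite mulrAC ltr_pdivrMr //; nra.
have T_disk s : - T <= s <= T -> `|s| * normc y < r.
  by rewrite -ler_norml => sT; apply: le_lt_trans Ty; rewrite ler_wpM2r ?normc_ge0.
have I_disk s : `]- T, T[%classic s -> `|s| * normc y < r.
  by rewrite /= in_itv /= => /andP[s1 s2]; apply: T_disk; rewrite !ltW.
have [|M _ uM] := @continuous_rectangle_bounded (fun p => u p.1 p.2) (- T) T (- pi) pi.
  by move=> s th /T_disk sT _; exact: continuous_Re_polar.
apply: (@continuity_under_integral _ _ _ mu u _ _ (- T) T _ _ (cst M)) => //.
- by move=> s /I_disk; exact: integrable_Re_polar.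
- apply: aeW => th _ s /[!inE] /I_disk sT.
  apply: (@cvg_comp _ _ _ (fun s' => (s', th)) (fun p : R * R => u p.1 p.2)).
    exact: cvg_pair cvg_id (cvg_cst _).
  exact: continuous_Re_polar.
- exact: (continuous_segment_integrable _ _ (@cst_continuous _ _ M)).
- move=> s; rewrite /= in_itv /= => /andP[s1 s2]; apply: aeW => th.
  by rewrite /= in_itv /=; apply: uM; rewrite !ltW.
- by rewrite inE /= in_itv /=; apply/andP; split; lra.
Qed.

Lemma circle_mean_radial :
  circle_mean (@complex.Re R \o h) a y = circle_mean (@complex.Re R \o h) a 0.
Proof.
pose I t := \int[mu]_(th in `[- pi, pi]) u t th.
have [||t _] := @MVT _ I (cst 0) 0 1 ltr01.
- by move=> t /[!in_itv]; exact: is_derive_circle_integral.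
- apply: continuous_in_subspaceT => t /[!inE] /= /[!in_itv].
  exact: continuous_circle_integral.
rewrite mul0r => /subr0_eq I01; congr (_ * _).
have polar1 th : a + y * cis th = polar a y 1 th by rewrite /polar mul1r.
have polar0 th : a + 0 * cis th = polar a y 0 th by rewrite /polar !mul0r.
by under eq_Rintegral do rewrite polar1; under [RHS]eq_Rintegral do rewrite polar0.
Qed.

End RadialIndependence.

Theorem mean_value_property h dh a y (r : R) : holomorphic_off_center h dh a r ->
  normc y < r -> circle_mean (@complex.Re R \o h) a y = complex.Re (h a).
Proof.
move=> hh yr; have [->|y0] := eqVneq y 0; first exact: circle_mean0.
by rewrite (circle_mean_radial y0 yr hh) circle_mean0.
Qed.

Theorem maximum_modulus_center h dh a (r : R) : holomorphic_off_center h dh a r ->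
  (forall z, normc (z - a) < r -> normc (h z) <= normc (h a)) ->
  forall z, normc (z - a) < r -> h z = h a.
Proof.
move=> hh h_max z zr.
have [c c1 cE] := normc_rotation (h a).
have c0 : c != 0 by rewrite -normc_gt0 c1.
have kh := holomorphic_off_centerZ c hh; set k := fun w => c * h w in kh.
have k_max w : normc (w - a) < r -> normc (k w) <= normc (h a).
  by move=> wr; rewrite normcM c1 mul1r h_max.
have circle_disk th : normc (a + (z - a) * cis th - a) < r.
  by rewrite addrAC subrr add0r normcM normc_cis mulr1.
apply: (mulfI c0); rewrite cE -[z in LHS](subrKC a).
apply: eq_real_normc_le_Re; first by rewrite subrKC k_max.
suff <- : complex.Re (k (a + (z - a))) = normc (h a) by [].
apply: (@circle_mean_eq_max (@complex.Re R \o k)).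
- move=> th; apply: cvg_Re.
  apply: (@continuous_cvg _ _ _ _ _ _ (k : Co -> Co)).
    by have [] := kh _ (circle_disk th).
  apply: cvgD; first exact: cvg_cst.
  apply: (@cvgM _ _ _ _ (cst (z - a) : R -> Co)); first exact: cvg_cst.
  exact: continuous_cis.
- by move=> th; apply: le_trans (Re_le_normc _) (k_max _ _).
- by rewrite (mean_value_property kh zr) /k cE.
Qed.

Theorem mean_value_equality_affine g dg a z (r M : R) :
  (forall w, normc (w - a) < r -> is_cderive g w (dg w) /\ ccontinuous dg w) ->
  (forall w, normc (w - a) < r -> normc (dg w) <= M) ->
  z != a -> normc (z - a) < r -> normc (g z - g a) = M * normc (z - a) ->
  forall w, normc (w - a) < r -> g w = g a + dg a * (w - a).
Proof.
move=> gh dgM za zr gE w wr.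
have gd v : normc (v - a) < r -> is_cderive g v (dg v) by move=> /gh[].
have nz : 0 < normc (z - a) by rewrite normc_gt0 subr_eq0.
have a_disk : normc (a - a) < r by rewrite subrr normc0 (lt_trans nz).
have slope_a : dslope g a a = dg a by rewrite dslope_diag (cderivE (gd _ a_disk)).
have dga : normc (dg a) = M.
  apply: (mulIf (lt0r_neq0 nz)); rewrite -gE.
  by rewrite (disk_mean_value_eq gd dgM zr gE) normcM.
rewrite -slope_a -[g w](subrKC (g a)) -dslopeM; congr (_ + _ * _).
apply: (@maximum_modulus_center _ (fun v => (dg v - dslope g a v) / (v - a)) a r) wr.
- move=> v vr; have [gdv dgc] := gh v vr.
  have [->|va] := eqVneq v a.
    by split; [exact: dslope_continuous (gd _ a_disk)|].
  have dslope_d := is_cderive_dslope va gdv.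
  have dslope_c := is_cderive_continuous dslope_d.
  split=> [|_]; [exact: dslope_c|split; first exact: dslope_d].
  have subc : ccontinuous (fun u => (u - a)^-1) v.
    by apply: cvgV (is_cderive_continuous (is_cderive_subr a v)); rewrite subr_eq0.
  exact: cvgM (cvgB dgc dslope_c) subc.
- move=> v vr; rewrite slope_a dga.
  have [->|va] := eqVneq v a; first by rewrite slope_a dga.
  rewrite -(@ler_pM2r _ (normc (v - a))) ?normc_gt0 ?subr_eq0 // -normcM dslopeM.
  by apply: disk_mean_value gd dgM _ _ _ _; rewrite ?inE.
Qed.

(** * The class Omega *)

Lemma is_cderive_quadratic c z : is_cderive (fun w => w + c * w ^+ 2) z (1 + 2 * c * z).
Proof. by apply: is_derive_eq; rewrite /GRing.scale /=; ring. Qed.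

Lemma cderiv_quadratic c z : cderiv (fun w => w + c * w ^+ 2) z = 1 + 2 * c * z.
Proof. exact: cderivE (is_cderive_quadratic c z). Qed.

Lemma Omega_quadratic (lam : R) (eta : C) : `|eta| = 1 ->
  Omega lam (fun w => w + lam%:C * eta * w ^+ 2).
Proof.
move=> eta1; split; first split.
- by move=> z _; case: (is_cderive_quadratic (lam%:C * eta) z).
- by rewrite cderiv_quadratic expr0n !mulr0 !addr0.
exists (fun=> eta); split; first by move=> z _; exact: derivable_cst.
split=> z _; first by rewrite eta1.
by rewrite cderiv_quadratic; ring.
Qed.

Lemma quadratic_extremal (lam e : R) z : `|e| = 1 -> z != 0 ->
  0 <= 1 + e * (2 * lam * normc z) ->
  exists eta : C, [/\ `|eta| = 1,
    normc (z + lam%:C * eta * z ^+ 2) = normc z + e * (lam * normc z ^+ 2) &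
    normc (cderiv (fun w => w + lam%:C * eta * w ^+ 2) z) = 1 + e * (2 * lam * normc z)].
Proof.
move=> e1 z0 df_ge0; exists (e%:C * (normc z)%:C / z).
have nz : 0 < normc z by rewrite normc_gt0.
have f_ge0 : 0 <= 1 + e * (lam * normc z) by lra.
split.
- rewrite normr_normc !normcM normcV !normc_real e1 mul1r ger0_norm ?ltW //.
  by rewrite divff // gt_eqF.
- have -> : normc z + e * (lam * normc z ^+ 2) = normc z * `|1 + e * (lam * normc z)|.
    by rewrite ger0_norm //; ring.
  rewrite -[`|1 + _|]normc_real -normcM; congr normc.
  by rewrite rmorphD !rmorphM rmorph1 /=; field.
- rewrite cderiv_quadratic -[RHS]ger0_norm // -normc_real; congr normc.
  by rewrite rmorphD !rmorphM rmorph1 rmorph_nat /=; field.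
Qed.

Lemma bound_normcE (lam : R) z :
  (lam%:C * `|z| ^+ 2 = (lam * normc z ^+ 2)%:C) *
  (2 * lam%:C * `|z| = (2 * lam * normc z)%:C).
Proof. by split; rewrite normr_normc !rmorphM ?rmorphXn ?rmorph_nat. Qed.

Section OmegaMembers.
Variables (lam : R) (f : C -> C).
Hypotheses (lam0 : 0 < lam) (Of : Omega lam f).

(* Dividing the defining equation by [z ^ 2] says that [f z / z], completed at [0]
   by [f'(0) = 1], has derivative [lam * phi z]. *)
Let q : C -> C := dslope f 0.

Lemma Omega_dslopeP : exists dq : C -> C, forall z, normc z < 1 ->
  [/\ normc (dq z) <= lam, ccontinuous dq z, is_cderive q z (dq z),
      f z = z * q z & cderiv f z = q z + z * dq z].
Proof.
have [[fA [f0 f1]] [phi [phiA [phi1 phiE]]]] := Of.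
pose dq z := lam%:C * phi z.
have fd z : normc z < 1 -> is_cderive f z (cderiv f z).
  by move=> z1; apply/derivable_is_cderive/fA; rewrite normr_lt1.
have dqc z : normc z < 1 -> ccontinuous dq z.
  rewrite -normr_lt1 => /phiA/derivable_is_cderive/is_cderive_continuous phic.
  exact: cvgM (cvg_cst (lam%:C : Co)) phic.
have zero_disk : normc (0 : C) < 1 by rewrite normc0 ltr01.
have fE z : f z = z * q z by have := dslopeM f 0 z; rewrite f0 !subr0 mulrC.
have dfE z : normc z < 1 -> cderiv f z = q z + z * dq z.
  have [->|z0] := eqVneq z 0; first by rewrite /q dslope_diag mul0r addr0.
  rewrite -normr_lt1 => /phiE /(canRL (subrK _)) zdfE.
  by apply: (mulfI z0); rewrite zdfE fE /dq; ring.
have qd z : z != 0 -> normc z < 1 -> is_cderive q z (dq z).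
  move=> z0 z1; apply: is_derive_eq (is_cderive_dslope z0 (fd z z1)) _.
  by rewrite dfE // -/(q z) subr0; field.
exists dq => z z1; split; [|exact: dqc| |exact: fE|exact: dfE].
  rewrite normcM normc_real gtr0_norm //; apply: ler_piMr; first exact: ltW.
  by rewrite -lecR -normr_normc phi1 // normr_lt1.
have [z_eq0|z0] := eqVneq z 0; last exact: qd.
rewrite z_eq0; apply: (is_cderive_removable (g := q) (dg := dq) ltr01).
- exact: dslope_continuous (fd 0 zero_disk).
- exact: dqc.
- by move=> w w0 w1; apply: qd w0 _; rewrite -[w]subr0.
Qed.

Lemma Omega_dslope0 : q 0 = 1.
Proof. by rewrite /q dslope_diag; have [[_ []]] := Of. Qed.

Lemma Omega_dslope_bound z : normc z < 1 -> normc (q z - 1) <= lam * normc z.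
Proof.
move=> z1; have [dq dqP] := Omega_dslopeP.
have dq_bound w : normc (w - 0) < 1 -> normc (dq w) <= lam by rewrite subr0 => /dqP[].
have qd w : normc (w - 0) < 1 -> is_cderive q w (dq w) by rewrite subr0 => /dqP[].
have := disk_mean_value qd dq_bound (x := z) (y := 0).
by rewrite Omega_dslope0 !inE !subr0 normc0; apply.
Qed.

Lemma Omega_growth z : normc z < 1 ->
  `|normc (f z) - normc z| <= normc z * normc (q z - 1).
Proof.
move=> z1; have [dq /(_ z z1)[_ _ _ -> _]] := Omega_dslopeP.
by rewrite -normcM; apply: le_trans (ler_dist_normc _ _) _; rewrite mulrBr mulr1.
Qed.

Lemma Omega_distortion z : normc z < 1 ->
  `|normc (cderiv f z) - 1| <= normc (q z - 1) + lam * normc z.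
Proof.
move=> z1; have [dq /(_ z z1)[dq_le _ _ _ ->]] := Omega_dslopeP.
rewrite -(normc1 R); apply: le_trans (ler_dist_normc _ _) _.
rewrite addrAC; apply: le_trans (le_normcD _ _) _.
by rewrite lerD2l normcM mulrC ler_wpM2r ?normc_ge0.
Qed.

Lemma Omega_bounds z : normc z < 1 ->
  normc z - lam * normc z ^+ 2 <= normc (f z) <= normc z + lam * normc z ^+ 2 /\
  1 - 2 * lam * normc z <= normc (cderiv f z) <= 1 + 2 * lam * normc z.
Proof.
move=> z1; have := Omega_dslope_bound z1.
have := Omega_growth z1; have := Omega_distortion z1; have := normc_ge0 z.
rewrite !ler_norml; move=> nz /andP[d1 d2] /andP[g1 g2] qb.
have : normc z * normc (q z - 1) <= lam * normc z ^+ 2.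
  by rewrite expr2 mulrCA ler_wpM2l.
by split; apply/andP; split; lra.
Qed.

Lemma Omega_bounds_equality z : z != 0 -> normc z < 1 ->
  (normc (f z) = normc z - lam * normc z ^+ 2 \/
   normc (f z) = normc z + lam * normc z ^+ 2 \/
   normc (cderiv f z) = 1 - 2 * lam * normc z \/
   normc (cderiv f z) = 1 + 2 * lam * normc z) ->
  normc (q z - 1) = lam * normc z.
Proof.
rewrite -normc_gt0 => nz z1 z_eq; apply/eqP; rewrite eq_le Omega_dslope_bound //=.
have := Omega_growth z1; have := Omega_distortion z1; rewrite !ler_norml.
move=> /andP[d1 d2] /andP[g1 g2]; move: z_eq => [f_eq|[f_eq|[df_eq|df_eq]]]; try lra.
  by rewrite -(ler_pM2l nz) mulrCA -expr2; lra.
by rewrite -(ler_pM2l nz) mulrCA -expr2; lra.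
Qed.

Lemma Omega_extremal z : z != 0 -> normc z < 1 -> normc (q z - 1) = lam * normc z ->
  exists eta : C, `|eta| = 1 /\
    forall w, `|w| < 1 -> f w = w + lam%:C * eta * w ^+ 2.
Proof.
move=> z0 z1 q_eq; have [dq dqP] := Omega_dslopeP.
have {}q_eq : normc (q z - q 0) = lam * normc (z - 0) by rewrite Omega_dslope0 subr0.
have q_affine w : normc w < 1 -> q w = 1 + dq 0 * w.
  rewrite -Omega_dslope0 -[w in normc w]subr0 -[w in dq 0 * w]subr0.
  apply: (mean_value_equality_affine _ _ z0 _ q_eq); last by rewrite subr0.
    by move=> v; rewrite subr0 => /dqP[].
  by move=> v; rewrite subr0 => /dqP[].
have dq0 : normc (dq 0) = lam.
  have nz : 0 < normc z by rewrite normc_gt0.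
  apply: (mulIf (lt0r_neq0 nz)); move: q_eq.
  by rewrite Omega_dslope0 q_affine // addrC addKr subr0 normcM.
have lamC0 : lam%:C != 0 :> C by rewrite -normc_gt0 normc_real gtr0_norm.
exists (dq 0 / lam%:C); split.
  by rewrite normr_normc normcM normcV dq0 normc_real gtr0_norm // divff ?gt_eqF.
move=> w; rewrite normr_lt1 => w1; have [_ _ _ -> _] := dqP w w1.
by rewrite q_affine //; field.
Qed.

Lemma Omega_starlike (r : R) : r <= 1 -> r <= 1 / (2 * lam) -> starlike_in_disk f r.
Proof.
move=> r1 r2 z; rewrite normr_gt0 => z0; rewrite normr_normc ltcR => zr.
have z1 : normc z < 1 := lt_le_trans zr r1.
have z2 : normc z * (2 * lam) < 1.
  by rewrite -ltr_pdivlMr ?mulr_gt0 //; exact: lt_le_trans r2.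
have [dq /(_ z z1)[dq_le _ _ -> ->]] := Omega_dslopeP.
have := Omega_dslope_bound z1; have := le_normcB 1 (1 - q z).
rewrite subKr normc1 [normc (1 - _)]normc_distC; move: (q z) => p p_ge p_le.
have np : 0 < normc p by lra.
have p0 : p != 0 by rewrite -normc_gt0.
have -> : z * (p + z * dq z) / (z * p) = 1 - (- (z * dq z / p)).
  by field; rewrite z0 p0.
rewrite raddfB /= subr_gt0; apply: le_lt_trans (Re_le_normc _) _.
rewrite normcN normcM normcV ltr_pdivrMr // mul1r normcM.
have : normc z * normc (dq z) <= normc z * lam by rewrite ler_wpM2l ?normc_ge0.
lra.
Qed.

End OmegaMembers.

Section RadiusOfStarlikeness.
Variable lam : R.
Hypothesis lam0 : 0 < lam.

Lemma Omega_starlike_radii f : Omega lam f ->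
  [set g : R | 0 < g <= 1 /\ (forall r : R, 0 < r <= g -> starlike_in_disk f r)]
    (Num.min 1 (1 / (2 * lam))).
Proof.
move=> Of; set m := Num.min _ _.
have m1 : m <= 1 by rewrite ge_min lexx.
have m2 : m <= 1 / (2 * lam) by rewrite ge_min lexx orbT.
split; first by rewrite m1 lt_min ltr01 divr_gt0 // mulr_gt0.
by move=> r /andP[_ rm]; apply: (Omega_starlike lam0 Of); exact: le_trans rm _.
Qed.

Lemma gamma_star_ge f : Omega lam f -> Num.min 1 (1 / (2 * lam)) <= gamma_star f.
Proof.
move=> Of; apply: ub_le_sup; first by exists 1 => g [/andP[]].
exact: Omega_starlike_radii.
Qed.

(* At [z = - t] the quotient [z f'(z) / f(z)] is [(1 - 2 lam t) / (1 - lam t)],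
   which is negative for [1 / (2 lam) < t < 1 / lam]. *)
Lemma starlike_quadratic_le (r : R) :
  starlike_in_disk (fun w => w + lam%:C * w ^+ 2) r -> r <= 1 / (2 * lam).
Proof.
move=> starlike; rewrite leNgt; apply/negP => r_gt.
set m := 1 / (2 * lam) in r_gt.
have mE : m * (2 * lam) = 1 by rewrite divfK // gt_eqF // mulr_gt0.
have m0 : 0 < m by rewrite divr_gt0 ?mulr_gt0.
have [t /andP[mt]] : exists t, m < t < Num.min r (2 * m).
  exists ((m + Num.min r (2 * m)) / 2).
  by rewrite !midf_lt // lt_min r_gt; lra.
rewrite lt_min => /andP[tr t2m].
have t0 := lt_trans m0 mt.
have nt : normc (- t%:C) = t by rewrite normcN normc_real gtr0_norm.
have tC0 : - t%:C != 0 :> C by rewrite -normc_gt0 nt.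
have := starlike (- t%:C); rewrite normr_normc nt !ltcR => /(_ t0 tr).
rewrite cderiv_quadratic.
have -> : - t%:C + lam%:C * (- t%:C) ^+ 2 = - t%:C * (1 - lam * t)%:C.
  by rewrite rmorphB rmorphM rmorph1 /=; ring.
have -> : 1 + 2 * lam%:C * - t%:C = (1 - 2 * lam * t)%:C.
  by rewrite rmorphB !rmorphM rmorph1 rmorph_nat /=; ring.
rewrite -mulf_div divff // mul1r -fmorphV -rmorphM /= pmulr_lgt0 ?invr_gt0; nra.
Qed.

Lemma radius_starlike_Omega : radius_starlike (@Omega R lam) = Num.min 1 (1 / (2 * lam)).
Proof.
pose k w := w + lam%:C * w ^+ 2.
have Ok : Omega lam k by have := Omega_quadratic lam (normr1 C); rewrite mulr1.
apply/eqP; rewrite eq_le; apply/andP; split; last first.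
  apply: lb_le_inf; first by exists (gamma_star k), k.
  by move=> _ [f /gamma_star_ge ? <-].
apply: (@le_trans _ _ (gamma_star k)).
  apply: ge_inf; last by exists k.
  by exists (Num.min 1 (1 / (2 * lam))) => _ [f /gamma_star_ge ? <-].
apply: ge_sup; first by eexists; exact: Omega_starlike_radii Ok.
move=> g [/andP[g0 g1] g_starlike]; rewrite le_min g1.
by apply/starlike_quadratic_le/g_starlike; rewrite g0 lexx.
Qed.

End RadiusOfStarlikeness.

End ComplexAnalysis.

Theorem theorem4p1 (R : realType) (lam : R) (hlam : 0 < lam) :
  (* radius of starlikeness (capped at 1, since members live on the unit disk) *)
  radius_starlike (@Omega R lam) = Num.min 1 (1 / (2 * lam))
  /\
  (forall f : R[i] -> R[i], Omega lam f ->
     (forall z : R[i], `|z| < 1 ->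
        `|z| - lam%:C * `|z| ^+ 2 <= `|f z| <= `|z| + lam%:C * `|z| ^+ 2 /\
        1 - 2 * lam%:C * `|z| <= `|cderiv f z| <= 1 + 2 * lam%:C * `|z|)
     /\
     (* equality case: equality at some z <> 0 in any of the bounds forces
        f to be an extremal function *)
     (forall z : R[i], `|z| < 1 -> z != 0 ->
        (`|f z| = `|z| - lam%:C * `|z| ^+ 2 \/
         `|f z| = `|z| + lam%:C * `|z| ^+ 2 \/
         `|cderiv f z| = 1 - 2 * lam%:C * `|z| \/
         `|cderiv f z| = 1 + 2 * lam%:C * `|z|) ->
        exists eta : R[i], `|eta| = 1 /\
          forall w : R[i], `|w| < 1 -> f w = w + lam%:C * eta * w ^+ 2))
  /\
  (* conversely, the extremal functions belong to Omega_lambda and attain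
     equality in both (upper, resp. lower) bounds at any given z <> 0 *)
  (forall eta : R[i], `|eta| = 1 ->
     Omega lam (fun w => w + lam%:C * eta * w ^+ 2))
  /\
  (forall z : R[i], `|z| < 1 -> z != 0 ->
     (exists eta : R[i], `|eta| = 1 /\
        let g := fun w => w + lam%:C * eta * w ^+ 2 in
        `|g z| = `|z| + lam%:C * `|z| ^+ 2 /\
        `|cderiv g z| = 1 + 2 * lam%:C * `|z|)
     /\
     (2 * lam%:C * `|z| <= 1 ->
      exists eta : R[i], `|eta| = 1 /\
        let g := fun w => w + lam%:C * eta * w ^+ 2 in
        `|g z| = `|z| - lam%:C * `|z| ^+ 2 /\
        `|cderiv g z| = 1 - 2 * lam%:C * `|z|)).
Proof.
have addE (x y : R) : x%:C + y%:C = (x + y)%:C by rewrite rmorphD.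
have subE (x y : R) : x%:C - y%:C = (x - y)%:C by rewrite rmorphB.
have oneE : 1 = (1 : R)%:C by [].
split; first exact: radius_starlike_Omega.
split=> [f Of|].
  split=> z; rewrite normr_lt1 => z1.
    rewrite !bound_normcE !normr_normc oneE !(addE, subE) !lecR.
    exact: (Omega_bounds hlam Of).
  move=> z0 z_eq; apply: (Omega_extremal hlam Of z0 z1).
  apply: (Omega_bounds_equality hlam Of z0 z1); move: z_eq.
  rewrite !bound_normcE !normr_normc oneE !(addE, subE).
  by move=> [/complexI|[/complexI|[/complexI|/complexI]]] ->; tauto.
split=> [|z z1 z0]; first exact: Omega_quadratic.
have lz : 0 < lam * normc z by rewrite mulr_gt0 ?normc_gt0.
rewrite !bound_normcE oneE lecR; split=> [|small].
  have [|eta [eta1 gE dgE]] := quadratic_extremal (lam := lam) (normr1 _) z0; first lra.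
  by exists eta; rewrite /= !normr_normc gE dgE !mul1r !addE.
have [|eta [eta1 gE dgE]] := quadratic_extremal (lam := lam) (normrN1 _) z0; first lra.
by exists eta; rewrite /= !normr_normc gE dgE !mulN1r !subE.
Qed.
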